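(* Let $(X,\mathcal A)$ be a measurable space, let $\mathrm S$ be a semicopula and let $\star\colon[0,1]^2\to[0,1]$ be non-decreasing and left-continuous such that $0\star1=1\star0=0$. The Chebyshev type inequality $$\mathbf I_{\mathrm S}(m,f\star g)\ge\mathbf I_{\mathrm S}(m,f)\star\mathbf I_{\mathrm S}(m,g)$$ is satisfied for any $\mathcal A$-measurable functions $f,g\colon X\to[0,1]$ comonotone on $X$ and any capacity $m$ on $(X,\mathcal A)$ if and only if $$\mathrm S(a\star b,c)\ge(\mathrm S(a,c)\star b)\vee(a\star\mathrm S(b,c))$$ is valid for all $a,b,c\in[0,1]$.
   Context: $(X,\mathcal A)$ is a measurable space ($X$ non-empty, $\mathcal A$ a $\sigma$-algebra). A capacity is a set function $m\colon\mathcal A\to[0,1]$ with $m(\emptyset)=0$, $m(X)=1$ and $m(A)\le m(B)$ whenever $A\subset B$. A binary operation on $[0,1]$ is non-decreasing if it is non-decreasing in both arguments, and a non-decreasing one is left-continuous if it is left-continuous in each coordinate. A semicopula is a non-decreasing function $\mathrm S\colon[0,1]^2\to[0,1]$ with $\mathrm S(a,1)=\mathrm S(1,a)=a$ for all $a\in[0,1]$. $a\vee b=\max(a,b)$. $f\star g$ is taken pointwise. The seminormed fuzzy integral of a measurable $f\colon X\to[0,1]$ is $\mathbf I_{\mathrm S}(m,f)=\sup_{t\in[0,1]}\mathrm S\big(t,m(\{f\ge t\})\big)$, where $\{f\ge t\}=\{x\in X:f(x)\ge t\}$. Functions $f,g$ are comonotone on $X$ if $(f(x)-f(y))(g(x)-g(y))\ge0$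 for all $x,y\in X$.
   Formalization: The ''only if'' direction is stated only when 𝒜 contains a set other than ∅ and X; for 𝒜={∅,X} the inequality always holds, yet the condition can fail (S product, ⋆ minimum, a=1/2, b=3/10, c=4/5). The ''if'' direction is stated for every measurable space. *)

(* Defs.v *)
From HB Require Import structures.
From mathcomp Require Import all_boot all_order all_algebra.
From mathcomp Require Import all_classical all_reals all_analysis.

Set Implicit Arguments.
Unset Strict Implicit.
Unset Printing Implicit Defensive.

Import Order.TTheory GRing.Theory Num.Theory.
Import numFieldNormedType.Exports.

Local Open Scope classical_set_scope.
Local Open Scope ring_scope.

(* Functions with domain or codomain [0,1] are represented by functions on R;
   every condition below only concerns their values on [0,1], and the values
   outside are irrelevant. *)

Section Operations.
Variable R : realType.
Implicit Types op S : R -> R -> R.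

Definition unit_op op : Prop :=
  forall a b : R, a \in `[0, 1] -> b \in `[0, 1] -> op a b \in `[0, 1].

Definition nondecreasing_op op : Prop :=
  (forall b : R, b \in `[0, 1] ->
     {in `[0, 1] &, {homo op^~ b : x y / x <= y}}) /\
  (forall a : R, a \in `[0, 1] ->
     {in `[0, 1] &, {homo op a : x y / x <= y}}).

(* At 0 there is no point of [0,1] to the left, hence the half-open interval:
   left-continuity at 0 is vacuous. *)
Definition left_continuous_op op : Prop :=
  (forall a b : R, a \in `]0, 1] -> b \in `[0, 1] ->
     op x b @[x --> a^'-] --> op a b) /\
  (forall a b : R, a \in `[0, 1] -> b \in `]0, 1] ->
     op a y @[y --> b^'-] --> op a b).

Record semicopula S : Prop := Semicopula {
  semicopula_unit : unit_op S ;
  semicopula_nondecreasing : nondecreasing_op S ;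
  semicopula_1r : forall a : R, a \in `[0, 1] -> S a 1 = a ;
  semicopula_1l : forall a : R, a \in `[0, 1] -> S 1 a = a }.

End Operations.

Section Capacities.
Variables (d : measure_display) (X : measurableType d) (R : realType).
Implicit Types (m : set X -> R) (f g : X -> R).

(* Only the values of [m] on measurable sets are constrained. *)
Record capacity m : Prop := Capacity {
  capacity_unit : forall A : set X, measurable A -> m A \in `[0, 1] ;
  capacity_set0 : m set0 = 0 ;
  capacity_setT : m setT = 1 ;
  capacity_mono : forall A B : set X,
    measurable A -> measurable B -> A `<=` B -> m A <= m B }.

Definition unit_mfun f : Prop :=
  measurable_fun setT f /\ forall x : X, f x \in `[0, 1].

Definition comonotone f g : Prop :=
  forall x y : X, 0 <= (f x - f y) * (g x - g y).

Definition seminormed_integral (S : R -> R -> R) m f : R :=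
  sup [set S t (m [set x | t <= f x]) | t in `[0, 1]].

Definition chebyshev_inequality (S star : R -> R -> R) : Prop :=
  forall (f g : X -> R) (m : set X -> R),
    unit_mfun f -> unit_mfun g -> comonotone f g -> capacity m ->
    star (seminormed_integral S m f) (seminormed_integral S m g)
      <= seminormed_integral S m (fun x => star (f x) (g x)).

End Capacities.

Arguments chebyshev_inequality {d} X {R} S star.

(* On the trivial sigma-algebra {set0, setT} the measurable functions are
   constant and every seminormed integral of a constant is that constant, so
   the Chebyshev inequality holds for every semicopula and every operation
   (for instance the product and the minimum, for which
   S (min a b) c >= min (S a c) b fails at a = 1/2, b = 3/10, c = 4/5).
   Deducing a condition on S and the operation from the inequality therefore
   requires a measurable set other than set0 and setT. *)
Definition nontrivial_sigma_algebra
    (d : measure_display) (X : measurableType d) : Prop :=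
  exists A : set X, [/\ measurable A, A <> set0 & A <> setT].

(* Main.v *)
(** Left-continuity and monotonicity of the operation in each variable give: if
    z < a * b, then z < p * q for some rational p, q, with p < a unless a = 0
    and q < b unless b = 0.  This makes f * g measurable.  It also reduces the
    Chebyshev inequality to S(t, m{f >= t}) * S(s, m{g >= s}) <= I(f * g):
    by comonotonicity one of the level sets {f >= t}, {g >= s} contains the
    other, the measure of the larger one is bounded by 1, and the condition on S
    and * concludes because the smaller one is included in {f * g >= t * s}.
    Conversely, the condition at (a, b, c) is the Chebyshev inequality for
    a 1_A and the constant b, resp. for the constant a and b 1_A, with respect
    to a capacity such that m(A) = c. *)
Require Import Defs.
From HB Require Import structures.
From mathcomp Require Import all_boot all_order all_algebra.
From mathcomp Require Import all_classical all_reals all_analysis.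
From mathcomp Require Import measurable_realfun.

Set Implicit Arguments.
Unset Strict Implicit.
Unset Printing Implicit Defensive.

Import Order.TTheory GRing.Theory Num.Theory.
Import numFieldNormedType.Exports.

Local Open Scope classical_set_scope.
Local Open Scope ring_scope.

(** * Rational approximation from the left *)

Lemma itv01_0 (R : realType) : (0 : R) \in `[0, 1].
Proof. by rewrite in_itv /= lexx ler01. Qed.

Lemma itv01_1 (R : realType) : (1 : R) \in `[0, 1].
Proof. by rewrite in_itv /= lexx ler01. Qed.

#[local] Hint Resolve itv01_0 itv01_1 : core.

(** For [0 < a], left-continuity yields some [x] in []0, a[] with [z < h x], and monotonicity
    carries the bound over to any rational between [x] and [a]. At [a = 0] the only candidate is
    [q = 0], which is why strictness is conditional. *)
Lemma left_continuous_gt_rat (R : realType) (h : R -> R) (a z : R) :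
  (a \in `]0, 1] -> h x @[x --> a^'-] --> h a) ->
  {in `[0, 1] &, {homo h : x y / x <= y}} ->
  a \in `[0, 1] -> z < h a ->
  exists q : rat, [/\ ratr q \in (`[0, 1] : interval R), ratr q <= a,
    (0 < a -> ratr q < a) & z < h (ratr q)].
Proof.
move=> cont_h mono_h a01 z_lt.
have /andP[a_ge0 a_le1] : 0 <= a <= 1 by rewrite in_itv in a01.
have [a0|a_neq0] := eqVneq a 0.
  by exists 0%Q; rewrite rmorph0 -{3}a0 itv01_0 a0 ltxx -{3}a0.
have a_gt0 : 0 < a by rewrite lt_def a_neq0.
have {}cont_h : h x @[x --> a^'-] --> h a by apply: cont_h; rewrite in_itv /= a_gt0.
have [x [x_lt [x_gt0 zx]]] : exists x, x < a /\ 0 < x /\ z < h x.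
  apply: (@filter_ex _ (a^'-)).
  by apply: filterI; [exact: nbhs_left_lt|apply: filterI;
    [exact: nbhs_left_gt|exact: (cvgr_gt _ cont_h)]].
have [q] := rat_in_itvoo x_lt; rewrite in_itv /= => /andP[x_lt_q q_lt_a].
have q01 : ratr q \in (`[0, 1] : interval R).
  by rewrite in_itv /= (ltW (lt_trans x_gt0 x_lt_q)) (ltW (lt_le_trans q_lt_a a_le1)).
exists q; split=> //; first exact: ltW.
apply: (lt_le_trans zx); apply: mono_h => //; last exact: ltW.
by rewrite in_itv /= (ltW x_gt0) (ltW (lt_le_trans x_lt a_le1)).
Qed.

Section Operations.
Variables (R : realType) (star : R -> R -> R).
Hypotheses (Hmono : nondecreasing_op star) (Hleft : left_continuous_op star).

Lemma nondecreasing_op_le (a b a' b' : R) :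
  a \in `[0, 1] -> b \in `[0, 1] -> a' \in `[0, 1] -> b' \in `[0, 1] ->
  a <= a' -> b <= b' -> star a b <= star a' b'.
Proof.
move=> a01 b01 a'01 b'01 aa' bb'; have [mono1 mono2] := Hmono.
exact: (le_trans (mono1 b b01 a a' a01 a'01 aa') (mono2 a' a'01 b b' b01 b'01 bb')).
Qed.

(** One coordinate at a time: first [a] is replaced by [p] with [b] fixed, then [b] by [q] with
    [ratr p] fixed. *)
Lemma left_continuous_op_gt_rat (a b z : R) :
  a \in `[0, 1] -> b \in `[0, 1] -> z < star a b ->
  exists p q : rat,
    [/\ ratr p \in (`[0, 1] : interval R), ratr p <= a & (0 < a -> ratr p < a)] /\
    [/\ ratr q \in (`[0, 1] : interval R), ratr q <= b,
        (0 < b -> ratr q < b) & z < star (ratr p) (ratr q)].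
Proof.
move=> a01 b01 z_lt; have [mono1 mono2] := Hmono; have [left1 left2] := Hleft.
have [||//|p [p01 pa pa0 zp]] := @left_continuous_gt_rat R (star^~ b) a z _ _ a01.
- by move=> a01'; exact: left1.
- exact: mono1.
have [||//|q [q01 qb qb0 zq]] := @left_continuous_gt_rat R (star (ratr p)) b z _ _ b01.
- by move=> b01'; exact: left2.
- exact: mono2.
by exists p, q.
Qed.

End Operations.

(** * Boundary behaviour of semicopulas *)

Lemma semicopula_le_l (R : realType) (S : R -> R -> R) (t c : R) :
  semicopula S -> t \in `[0, 1] -> c \in `[0, 1] -> S t c <= t.
Proof.
move=> HS t01 c01; rewrite -[leRHS](semicopula_1r HS t01).
apply: (nondecreasing_op_le (semicopula_nondecreasing HS)) => //.
by move: c01; rewrite in_itv /= => /andP[].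
Qed.

Lemma semicopula0 (R : realType) (S : R -> R -> R) (c : R) :
  semicopula S -> c \in `[0, 1] -> S 0 c = 0.
Proof.
move=> HS c01; apply/eqP; rewrite eq_le semicopula_le_l//=.
by have := semicopula_unit HS (@itv01_0 R) c01; rewrite in_itv /= => /andP[].
Qed.

Lemma semicopulax0 (R : realType) (S : R -> R -> R) (t : R) :
  semicopula S -> t \in `[0, 1] -> S t 0 = 0.
Proof.
move=> HS t01; apply/eqP; rewrite eq_le.
have := semicopula_unit HS t01 (@itv01_0 R); rewrite in_itv /= => /andP[-> _].
rewrite andbT -[leRHS](semicopula_1l HS (@itv01_0 R)).
apply: (nondecreasing_op_le (semicopula_nondecreasing HS)) => //.
by move: t01; rewrite in_itv /= => /andP[].
Qed.

(** * Level sets, bounds of the integral and measurability *)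

Section Integral.
Variables (R : realType) (d : measure_display) (X : measurableType d).
Implicit Types (S star : R -> R -> R) (f g : X -> R) (m : set X -> R).

Lemma measurable_level f (t : R) :
  measurable_fun setT f -> measurable [set x | t <= f x].
Proof.
move=> mf; rewrite -[X in measurable X]setTI.
exact: (measurable_fun_le measurableT (@measurable_cst _ _ _ _ _ t) mf).
Qed.

Lemma capacity_level_unit m f (t : R) :
  capacity m -> unit_mfun f -> m [set x | t <= f x] \in `[0, 1].
Proof. by move=> Hm [mf _]; apply: (capacity_unit Hm); exact: measurable_level. Qed.

(** Together with non-emptiness, this makes [sup] a genuine supremum rather than its default
    value. *)
Lemma seminormed_integral_ubound S m f :
  semicopula S -> capacity m -> unit_mfun f ->
  ubound [set S t (m [set x | t <= f x]) | t in `[0, 1]] 1.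
Proof.
move=> HS Hm Hf _ [t /= t01 <-].
have := semicopula_unit HS t01 (capacity_level_unit t Hm Hf).
by rewrite in_itv /= => /andP[].
Qed.

Lemma seminormed_values_nonempty S m f :
  [set S t (m [set x | t <= f x]) | t in `[0, 1]] !=set0.
Proof. by exists (S 0 (m [set x | 0 <= f x])), 0 => //=; exact: itv01_0. Qed.

Lemma seminormed_integral_ge S m f (t : R) :
  semicopula S -> capacity m -> unit_mfun f -> t \in `[0, 1] ->
  S t (m [set x | t <= f x]) <= seminormed_integral S m f.
Proof.
move=> HS Hm Hf t01; rewrite /seminormed_integral; set E := [set _ | _ in _].
have supE : has_sup E.
  split; first exact: (seminormed_values_nonempty S m f).
  by exists 1; exact: (seminormed_integral_ubound HS Hm Hf).
by apply: (sup_upper_bound supE); exists t.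
Qed.

Lemma seminormed_integral_unit S m f :
  semicopula S -> capacity m -> unit_mfun f ->
  seminormed_integral S m f \in `[0, 1].
Proof.
move=> HS Hm Hf; rewrite in_itv /=; apply/andP; split.
  rewrite -(semicopula0 HS (capacity_level_unit 0 Hm Hf)).
  exact: seminormed_integral_ge.
exact: (ge_sup (seminormed_values_nonempty S m f) (seminormed_integral_ubound HS Hm Hf)).
Qed.

(** The set where the combined function exceeds [z] is a countable union of intersections of level
    sets of [f] and [g] at rational heights [p], [q] with [z < star p q]: left-continuity gives one
    inclusion, monotonicity the other. *)
Lemma unit_mfun_star star f g :
  unit_op star -> nondecreasing_op star -> left_continuous_op star ->
  unit_mfun f -> unit_mfun g -> unit_mfun (fun x => star (f x) (g x)).
Proof.
move=> Hstar Hmono Hleft [mf f01] [mg g01]; split; last by move=> x; exact: Hstar.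
apply: (measurability _ (RGenOInfty.measurableE R)) => _ [_ [z ->] <-].
(* The first factor does not depend on [x]: it is everything or empty, so the union can range over
   all pairs of rationals. *)
pose E (p q : rat) := [set x : X | [/\ ratr p \in (`[0, 1] : interval R),
  ratr q \in (`[0, 1] : interval R) & z < star (ratr p) (ratr q)]] `&`
  ([set x | ratr p <= f x] `&` [set x | ratr q <= g x]).
rewrite (_ : _ `&` _ = \bigcup_p \bigcup_q E p q); last first.
  apply/seteqP; split=> x /=.
    move=> [_]; rewrite in_itv /= andbT => z_lt.
    have [p [q [[p01 pf _] [q01 qg _ zpq]]]] :=
      left_continuous_op_gt_rat Hmono Hleft (f01 x) (g01 x) z_lt.
    by exists p => //; exists q.
  move=> [p _ [q _ [[p01 q01 zpq] [/= pf qg]]]]; split=> //.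
  rewrite in_itv /= andbT; apply: (lt_le_trans zpq).
  exact: nondecreasing_op_le.
apply: bigcupT_measurable_rat => p; apply: bigcupT_measurable_rat => q.
apply: measurableI; last by apply: measurableI; exact: measurable_level.
have [pq|npq] := pselect [/\ ratr p \in (`[0, 1] : interval R),
  ratr q \in (`[0, 1] : interval R) & z < star (ratr p) (ratr q)].
  by rewrite (_ : [set _ | _] = setT)//; apply/seteqP; split.
by rewrite (_ : [set _ | _] = set0)//; apply/seteqP; split.
Qed.

(** * Sufficiency of the condition *)

Lemma comonotone_nested f g (s t : R) : comonotone f g ->
  [set x | t <= f x] `<=` [set x | s <= g x] \/
  [set x | s <= g x] `<=` [set x | t <= f x].
Proof.
move=> fg; have [|ntf] := pselect ([set x | t <= f x] `<=` [set x | s <= g x]).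
  by left.
(* If both inclusions failed, at [x] and [y] say, then [f y < t <= f x] and [g x < s <= g y], so the
   product of the differences would be negative. *)
right=> y /= sy; rewrite leNgt; apply/negP => fy; apply: ntf => x /= tx.
rewrite leNgt; apply/negP => gx.
have := fg x y; rewrite leNgt nmulr_llt0 ?subr_gt0 ?(lt_le_trans fy)//.
by rewrite subr_lt0 (lt_le_trans gx).
Qed.

Lemma chebyshev_sufficient S star :
  semicopula S -> unit_op star -> nondecreasing_op star ->
  left_continuous_op star -> star 0 1 = 0 -> star 1 0 = 0 ->
  (forall a b c : R, a \in `[0, 1] -> b \in `[0, 1] -> c \in `[0, 1] ->
    Num.max (star (S a c) b) (star a (S b c)) <= S (star a b) c) ->
  chebyshev_inequality X S star.
Proof.
move=> HS Hstar Hmono Hleft H01 H10 Hdom f g m Hf Hg fg Hm.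
have Hfg := unit_mfun_star Hstar Hmono Hleft Hf Hg.
have F01 := seminormed_integral_unit HS Hm Hf.
have G01 := seminormed_integral_unit HS Hm Hg.
have FG01 := seminormed_integral_unit HS Hm Hfg.
have [F_ge0 F_le1] : 0 <= seminormed_integral S m f /\ seminormed_integral S m f <= 1.
  by move: F01; rewrite in_itv /= => /andP.
have [G_ge0 G_le1] : 0 <= seminormed_integral S m g /\ seminormed_integral S m g <= 1.
  by move: G01; rewrite in_itv /= => /andP.
have FG_ge0 : 0 <= seminormed_integral S m (fun x => star (f x) (g x)).
  by move: FG01; rewrite in_itv /= => /andP[].
(* A zero integral cannot be approximated strictly from below within the unit interval; there the
   left-hand side is at most [star 0 1] or [star 1 0], hence 0. *)
have [F0|F_neq0] := eqVneq (seminormed_integral S m f) 0.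
  by apply: le_trans FG_ge0; rewrite F0 -[leRHS]H01; exact: nondecreasing_op_le.
have [G0|G_neq0] := eqVneq (seminormed_integral S m g) 0.
  by apply: le_trans FG_ge0; rewrite G0 -[leRHS]H10; exact: nondecreasing_op_le.
rewrite leNgt; apply/negP => /(left_continuous_op_gt_rat Hmono Hleft F01 G01).
move=> [p [q [[p01 _ pF] [q01 _ qG]]]]; apply/negP; rewrite -leNgt.
have {}pF : ratr p < seminormed_integral S m f by apply: pF; rewrite lt_def F_neq0.
have {}qG : ratr q < seminormed_integral S m g by apply: qG; rewrite lt_def G_neq0.
(* As [p] and [q] lie strictly below the two suprema, levels [t] and [s] exist whose values are at
   least [p] and [q]. *)
have [_ [t /= t01 <-] /ltW pt] := sup_gt (seminormed_values_nonempty S m f) pF.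
have [_ [s /= s01 <-] /ltW qs] := sup_gt (seminormed_values_nonempty S m g) qG.
have A01 := capacity_level_unit t Hm Hf; have B01 := capacity_level_unit s Hm Hg.
have FGts : S (star t s) (m [set x | star t s <= star (f x) (g x)]) <=
    seminormed_integral S m (fun x => star (f x) (g x)).
  by apply: seminormed_integral_ge => //; exact: Hstar.
(* On such a [C] one has [star t s <= star (f x) (g x)] by monotonicity; [C] will be the smaller of
   the two level sets. *)
have mAB (C : set X) : measurable C -> C `<=` [set x | t <= f x] ->
    C `<=` [set x | s <= g x] ->
    S (star t s) (m C) <= seminormed_integral S m (fun x => star (f x) (g x)).
  move=> mC CA CB; apply: le_trans FGts.
  have mts : measurable [set x | star t s <= star (f x) (g x)].
    by apply: measurable_level; exact: Hfg.1.
  apply: (nondecreasing_op_le (semicopula_nondecreasing HS)) => //.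
  - exact: Hstar.
  - exact: (capacity_unit Hm).
  - exact: Hstar.
  - exact: (capacity_unit Hm).
  apply: (capacity_mono Hm) => // x Cx /=.
  by apply: (nondecreasing_op_le Hmono) => //; [exact: Hf.2|exact: Hg.2|exact: CA|exact: CB].
have StA01 := semicopula_unit HS t01 A01; have SsB01 := semicopula_unit HS s01 B01.
have step := nondecreasing_op_le Hmono p01 q01 StA01 SsB01 pt qs.
apply: (le_trans step).
have [AB|BA] := comonotone_nested s t fg.
  have mA : measurable [set x | t <= f x] by apply: measurable_level; exact: Hf.1.
  apply: le_trans (mAB _ mA (@subset_refl _ _) AB).
  (* The larger set enters only through [S s _ <= s], so the first term of the maximum suffices; the
     other case is symmetric. *)
  have := Hdom t s _ t01 s01 A01; rewrite ge_max => /andP[+ _]; apply: le_trans.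
  by apply: (nondecreasing_op_le Hmono) => //; exact: semicopula_le_l.
have mB : measurable [set x | s <= g x] by apply: measurable_level; exact: Hg.1.
apply: le_trans (mAB _ mB BA (@subset_refl _ _)).
have := Hdom t s _ t01 s01 B01; rewrite ge_max => /andP[_ +]; apply: le_trans.
by apply: (nondecreasing_op_le Hmono) => //; exact: semicopula_le_l.
Qed.

(** * Necessity: test functions and test capacities *)

Lemma unit_mfun_indic (A : set X) (a : R) :
  measurable A -> a \in `[0, 1] -> unit_mfun (fun x => a * \1_A x).
Proof.
move=> mA a01; split=> [|x].
  by apply: measurable_funM => //; exact: measurable_indic.
by rewrite indicE; case: (_ \in _); rewrite ?mulr1 ?mulr0.
Qed.

(** The level [t = a] provides the lower bound. For the upper one, levels [0 < t <= a] give sets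
    inside [A], levels above [a] give the empty set, and level 0, whose level set is all of [X],
    contributes [S 0 _ = 0]. *)
Lemma seminormed_integral_indic S m (A : set X) (a : R) :
  semicopula S -> capacity m -> measurable A -> a \in `[0, 1] ->
  seminormed_integral S m (fun x => a * \1_A x) = S a (m A).
Proof.
move=> HS Hm mA a01; have mA01 := capacity_unit Hm mA.
have Hf := unit_mfun_indic mA a01.
have [a_ge0 a_le1] : 0 <= a /\ a <= 1 by move: a01; rewrite in_itv /= => /andP.
have SaA01 := semicopula_unit HS a01 mA01.
have SaA_ge0 : 0 <= S a (m A) by move: SaA01; rewrite in_itv /= => /andP[].
apply/eqP; rewrite eq_le; apply/andP; split; last first.
  apply: le_trans (seminormed_integral_ge HS Hm Hf a01).
  have L01 := capacity_level_unit a Hm Hf.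
  apply: (nondecreasing_op_le (semicopula_nondecreasing HS)) => //.
  apply: (capacity_mono Hm) => //; first by apply: measurable_level; exact: Hf.1.
  by move=> x Ax /=; rewrite indicE mem_set// mulr1.
apply: (ge_sup (seminormed_values_nonempty S m _)) => _ [t /= t01 <-].
have L01 := capacity_level_unit t Hm Hf.
have [t0|t_neq0] := eqVneq t 0; first by rewrite t0 in L01 *; rewrite semicopula0.
have t_gt0 : 0 < t by move: t01; rewrite lt_def t_neq0 in_itv /= => /andP[].
have [ta|lt_at] := leP t a.
  apply: (nondecreasing_op_le (semicopula_nondecreasing HS)) => //.
  apply: (capacity_mono Hm) => //; first by apply: measurable_level; exact: Hf.1.
  move=> x /=; rewrite indicE; have [/set_mem//|_] := boolP (x \in A).
  by rewrite mulr0 leNgt t_gt0.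
rewrite (_ : [set x | _] = set0) ?(capacity_set0 Hm) ?semicopulax0//.
apply/seteqP; split=> // x /=; apply/negP; rewrite -ltNge.
by apply: le_lt_trans lt_at; rewrite indicE; case: (_ \in _); rewrite ?mulr1 ?mulr0.
Qed.

Lemma seminormed_integral_cst S m (a : R) :
  semicopula S -> capacity m -> a \in `[0, 1] ->
  seminormed_integral S m (fun=> a) = a.
Proof.
move=> HS Hm a01; rewrite -[RHS](semicopula_1r HS a01) -(capacity_setT Hm).
rewrite -seminormed_integral_indic//; congr (seminormed_integral _ _ _).
by apply/funext => x; rewrite indicT mulr1.
Qed.

(** The capacity takes only the values 0, [c] and 1. Since [A] is non-empty, the empty set gets 0;
    since [A] is not the whole space, [A] gets [c] and not 1. *)
Lemma capacity_prescribed (A : set X) (c : R) :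
  A <> set0 -> A <> setT -> c \in `[0, 1] ->
  exists2 m : set X -> R, capacity m & m A = c.
Proof.
move=> A0 AT c01.
have [c_ge0 c_le1] : 0 <= c /\ c <= 1 by move: c01; rewrite in_itv /= => /andP.
pose m (B : set X) : R := if `[< B = setT >] then 1 else if `[< A `<=` B >] then c else 0.
exists m; last by rewrite /m asboolF// asboolT.
split.
- by move=> B _; rewrite /m; case: ifP => // _; case: ifP.
- rewrite /m asboolF; last by move=> e; apply: AT; apply/seteqP; split=> // x; rewrite -e.
  by rewrite asboolF// subset0.
- by rewrite /m asboolT.
- move=> B C _ _ BC; rewrite /m.
  have [CT|CT] := asboolP (C = setT); first by case: ifP => // _; case: ifP.
  rewrite asboolF; last by move=> BT; apply: CT; apply/seteqP; split=> // x _; apply: BC; rewrite BT.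
  have [AB|_] := asboolP (A `<=` B); first by rewrite asboolT//; exact: subset_trans BC.
  by case: ifP.
Qed.

Lemma chebyshev_necessary S star :
  semicopula S -> unit_op star -> nondecreasing_op star ->
  star 0 1 = 0 -> star 1 0 = 0 ->
  nontrivial_sigma_algebra X -> chebyshev_inequality X S star ->
  forall a b c : R, a \in `[0, 1] -> b \in `[0, 1] -> c \in `[0, 1] ->
    Num.max (star (S a c) b) (star a (S b c)) <= S (star a b) c.
Proof.
move=> HS Hstar Hmono H01 H10 [A [mA A0 AT]] Hcheb a b c a01 b01 c01.
have [m Hm mAc] := capacity_prescribed A0 AT c01.
have unit_cst (v : R) : v \in `[0, 1] -> unit_mfun (fun _ : X => v).
  by move=> v01; split=> //; exact: measurable_cst.
(* The vanishing of [star 0 v] and [star v 0] ensures that combining a multiple of the indicator of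
   [A] with a constant gives 0 off [A], hence again a multiple of that indicator. *)
have star0x (v : R) : v \in `[0, 1] -> star 0 v = 0.
  move=> v01; have := Hstar 0 v (itv01_0 _) v01; rewrite in_itv /= => /andP[ge0 _].
  apply/eqP; rewrite eq_le [X in _ && X]ge0 andbT -[leRHS]H01; apply: nondecreasing_op_le => //.
  by move: v01; rewrite in_itv /= => /andP[].
have starx0 (v : R) : v \in `[0, 1] -> star v 0 = 0.
  move=> v01; have := Hstar v 0 v01 (itv01_0 _); rewrite in_itv /= => /andP[ge0 _].
  apply/eqP; rewrite eq_le [X in _ && X]ge0 andbT -[leRHS]H10; apply: nondecreasing_op_le => //.
  by move: v01; rewrite in_itv /= => /andP[].
have ab01 := Hstar a b a01 b01.
rewrite ge_max; apply/andP; split.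
(* A constant is comonotone with every function. *)
- have cm : comonotone (fun x => a * \1_A x) (fun _ : X => b).
    by move=> x y; rewrite subrr mulr0.
  have := Hcheb _ _ m (unit_mfun_indic mA a01) (unit_cst b b01) cm Hm.
  rewrite seminormed_integral_indic// seminormed_integral_cst// mAc.
  rewrite (_ : (fun x => star _ _) = (fun x => star a b * \1_A x)).
    by rewrite seminormed_integral_indic// mAc.
  apply/funext => x; rewrite indicE.
  by case: (_ \in _); rewrite ?mulr1 // !mulr0 star0x.
- have cm : comonotone (fun _ : X => a) (fun x => b * \1_A x).
    by move=> x y; rewrite subrr mul0r.
  have := Hcheb _ _ m (unit_cst a a01) (unit_mfun_indic mA b01) cm Hm.
  rewrite seminormed_integral_indic// seminormed_integral_cst// mAc.
  rewrite (_ : (fun x => star _ _) = (fun x => star a b * \1_A x)).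
    by rewrite seminormed_integral_indic// mAc.
  apply/funext => x; rewrite indicE.
  by case: (_ \in _); rewrite ?mulr1 // !mulr0 starx0.
Qed.

End Integral.

Theorem corollary4p4 (R : realType) (d : measure_display) (X : measurableType d)
    (S star : R -> R -> R) (HS : semicopula S)
    (Hstar : unit_op star) (Hmono : nondecreasing_op star)
    (Hleft : left_continuous_op star)
    (H01 : star 0 1 = 0) (H10 : star 1 0 = 0) :
  ((forall a b c : R, a \in `[0, 1] -> b \in `[0, 1] -> c \in `[0, 1] ->
      Num.max (star (S a c) b) (star a (S b c)) <= S (star a b) c) ->
    chebyshev_inequality X S star) /\
  (nontrivial_sigma_algebra X ->
    chebyshev_inequality X S star ->
    (forall a b c : R, a \in `[0, 1] -> b \in `[0, 1] -> c \in `[0, 1] ->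
      Num.max (star (S a c) b) (star a (S b c)) <= S (star a b) c)).
Proof.
split; first exact: chebyshev_sufficient.
exact: chebyshev_necessary.
Qed.
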